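(* Let $\mathcal{X}$ be a compact Polish space, $\mathcal{L}:\mathcal{X}\to[-\infty,\infty)$ upper semicontinuous, $P\in\mathcal{P}(\mathcal{X})$, $D$ a pre-divergence such that $Q\mapsto D(Q\|P)$ is lower semicontinuous, and $c$ a cost function with $c(x_1,x_2)=0$ if and only if $x_1=x_2$. For $r>0$ let $c_r=rc$. Then for every $\epsilon>0$, \[\lim_{r\to\infty}\sup_{Q:D^{c_r}(Q\|P)\leq \epsilon}E_Q[\mathcal{L}]=\sup_{Q:D(Q\|P)\leq\epsilon}E_Q[\mathcal{L}].\] Moreover, if $\{\mathcal{L}_\theta\}_{\theta\in\Theta}$ is a family of upper semicontinuous functions $\mathcal{X}\to[-\infty,\infty)$, then \[\lim_{r\to\infty}\inf_{\theta\in\Theta}\sup_{Q:D^{c_r}(Q\|P)\leq \epsilon}E_Q[\mathcal{L}_\theta]=\inf_{\theta\in\Theta}\sup_{Q:D(Q\|P)\leq\epsilon}E_Q[\mathcal{L}_\theta].\]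
   Context: $\mathcal{P}(\mathcal{X})$ is the set of Borel probability measures on $\mathcal{X}$ with the weak topology; suprema are over $Q\in\mathcal{P}(\mathcal{X})$. A pre-divergence is $D:\mathcal{P}(\mathcal{X})\times\mathcal{P}(\mathcal{X})\to[0,\infty]$ with $D(\mu\|\mu)=0$ for all $\mu$. A cost function is a lower semicontinuous $c:\mathcal{X}\times\mathcal{X}\to[0,\infty]$; for a cost function $c'$ its OT cost is $C'(\mu,\nu)=\inf\{\int c'\,d\pi:\pi_1=\mu,\pi_2=\nu\}$ and $D^{c'}(\nu\|\mu)=\inf_{\eta\in\mathcal{P}(\mathcal{X})}\{D(\eta\|\mu)+C'(\eta,\nu)\}$. *)

(* Defs.v *)
From HB Require Import structures.
From mathcomp Require Import all_boot all_order all_algebra.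
From mathcomp Require Import all_classical all_reals all_analysis.
Set Implicit Arguments. Unset Strict Implicit. Unset Printing Implicit Defensive.
Import Order.TTheory GRing.Theory Num.Theory.
Import numFieldNormedType.Exports.
Local Open Scope classical_set_scope.
Local Open Scope ring_scope.

Definition borel (X : ptopologicalType) : measurableType _ :=
  g_sigma_algebraType (@open X).

Definition Prob (R : realType) (X : ptopologicalType) := probability (borel X) R.

Local Open Scope ereal_scope.

Definition upper_semicontinuous (X : topologicalType) (R : numFieldType)
  (f : X -> \bar R) := forall x (a : R), f x < a%:E ->
  exists2 V, nbhs x V & forall y, V y -> f y < a%:E.

Definition bounded_continuous (R : realType) (X : topologicalType) (f : X -> R) :=
  continuous f /\ exists M : R, forall x, (`|f x| <= M)%R.

Definition weak_open (R : realType) (X : ptopologicalType)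
  (U : set (Prob R X)) :=
  forall Q0, U Q0 -> exists (n : nat) (f : 'I_n -> X -> R) (e : R),
    (0 < e)%R /\ (forall i, bounded_continuous (f i)) /\
    (forall Q : Prob R X,
       (forall i, `| \int[Q]_x (f i x)%:E - \int[Q0]_x (f i x)%:E | < e%:E) ->
       U Q).

Definition weak_lsc (R : realType) (X : ptopologicalType)
  (F : Prob R X -> \bar R) :=
  forall a : R, weak_open [set Q | a%:E < F Q].

Definition pre_divergence (R : realType) (X : ptopologicalType)
  (D : Prob R X -> Prob R X -> \bar R) :=
  (forall mu nu, 0 <= D mu nu) /\ (forall mu, D mu mu = 0).

Definition cost_function (R : realType) (X : ptopologicalType)
  (c : X * X -> \bar R) :=
  (forall z, 0 <= c z) /\ lower_semicontinuous c.

Definition coupling (R : realType) (X : ptopologicalType)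
  (mu nu : Prob R X) (pi : probability (borel X * borel X)%type R) :=
  forall A : set (borel X), measurable A ->
    pi (A `*` setT) = mu A /\ pi (setT `*` A) = nu A.

Definition OTcost (R : realType) (X : ptopologicalType)
  (c : X * X -> \bar R) (mu nu : Prob R X) : \bar R :=
  ereal_inf [set \int[pi]_z c z | pi in coupling mu nu].

Definition Dc (R : realType) (X : ptopologicalType)
  (D : Prob R X -> Prob R X -> \bar R) (c : X * X -> \bar R)
  (nu mu : Prob R X) : \bar R :=
  ereal_inf [set D eta mu + OTcost c eta nu | eta in [set: Prob R X]].

Definition worst_case (R : realType) (X : ptopologicalType)
  (Div : Prob R X -> Prob R X -> \bar R) (P : Prob R X) (eps : R)
  (L : X -> \bar R) : \bar R :=
  ereal_sup [set \int[Q]_x L x | Q in [set Q | Div Q P <= eps%:E]].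

Definition scale_cost (R : realType) (X : Type) (r : R) (c : X * X -> \bar R) :=
  fun z => r%:E * c z.

(* Main.v *)
(** By compactness and lower semicontinuity, [c] is bounded below by a positive
    constant on every compact set off the diagonal.  Hence if [D^{c_r}(Q_r||P)
    <= eps] with [r -> +oo], near-optimal intermediate measures [eta_r] and
    couplings of [eta_r] with [Q_r] transport a vanishing mass out of any
    neighborhood of any closed set, so [eta_r] and [Q_r] have the same weak
    cluster points [mu].  Such a [mu] satisfies [D(mu||P) <= eps] by lower
    semicontinuity, and [E_mu L] dominates the limit of [E_{Q_r} L] because
    [L] is upper semicontinuous.

    The cluster point comes from an ultrafilter on the sequence: the limits of
    [eta_r K] over closed sets [K] form a content, which the inner/outer
    regularization and Caratheodory's theorem turn into a Borel probability
    measure.  Both semicontinuity properties then follow from the inequality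
    [mu U <= lim nu_r U] on open sets, by approximating lower semicontinuous
    functions by sums of indicators of their superlevel sets. *)

Require Import Defs.
From HB Require Import structures.
From mathcomp Require Import all_boot all_order all_algebra.
From mathcomp Require Import all_classical all_reals all_analysis.
From mathcomp Require Import measurable_realfun lra.
Import Order.TTheory GRing.Theory Num.Theory.
Import numFieldNormedType.Exports.
Local Open Scope classical_set_scope.
Local Open Scope ring_scope.

Set Implicit Arguments.
Unset Strict Implicit.
Unset Printing Implicit Defensive.

(** * From contents to Borel measures *)

(** Near-covering compactness, applied to the filter [\oo]: once [V m] is a neighborhood of [x],
    monotonicity keeps it one for all larger indices. *)
Lemma compact_nondecreasing_cover (T : topologicalType) (K : set T)
    (V : (set T)^nat) :
  compact K -> (forall n, open (V n)) -> nondecreasing_seq V ->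
  K `<=` \bigcup_n V n -> exists n, K `<=` V n.
Proof.
move=> /compact_near_coveringP cK oV ndV KV.
suff : \forall n \near \oo, K `<=` V n by move=> /filter_ex.
apply: cK => x /KV[m _ Vmx].
exists (V m, [set n | (m <= n)%N]) => /=.
  split; first exact: open_nbhs_nbhs.
  exact: nbhs_infty_ge.
by move=> [y n] [/= Vmy mn]; have /subsetPset := ndV _ _ mn; exact.
Qed.

Lemma normal_closed_shrink (T : topologicalType) (K U : set T) :
  normal_space T -> closed K -> open U -> K `<=` U ->
  exists V, [/\ open V, K `<=` V & closure V `<=` U].
Proof.
move=> nT cK oU KU.
have /(nT K cK) [A KA AU] : set_nbhs K U by apply/set_nbhsP; exists U; split.
have [V [oV KV VA]] := (set_nbhsP _ _).1 KA.
by exists V; split => //; apply: subset_trans AU; exact: closureS.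
Qed.

(** The closed set [K \ U] lies in [V]; normality puts an open [W] around it with closure still in
    [V], and [K] is cut along [W]. *)
Lemma normal_closed_setU (T : topologicalType) (K U V : set T) :
  normal_space T -> closed K -> open U -> open V -> K `<=` U `|` V ->
  exists A B, [/\ closed A, closed B, A `<=` U, B `<=` V & K = A `|` B].
Proof.
move=> nT cK oU oV KUV.
have [|||W [oW KUW WV]] := @normal_closed_shrink T (K `\` U) V nT.
- by rewrite setDE; apply: closedI => //; exact: open_closedC.
- by [].
- by move=> x [/KUV[]].
exists (K `\` W), (K `&` closure W); split.
- by rewrite setDE; apply: closedI => //; exact: open_closedC.
- by apply: closedI => //; exact: closed_closure.
- move=> x [Kx nWx]; apply: contrapT => Ux; exact/nWx/KUW.
- by move=> x [_ /WV].
- apply/seteqP; split => [x Kx|x [[]|[]]//].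
  have [Wx|nWx] := pselect (W x); last by left.
  by right; split => //; exact: subset_closure.
Qed.

Section content.
Local Open Scope ereal_scope.
Context (R : realType) (T : ptopologicalType).
Hypotheses (hT : hausdorff_space T) (cT : compact [set: T]).
Variable m : set T -> \bar R.
Hypothesis m0 : m set0 = 0.
Hypothesis le_m : forall A B, closed A -> closed B -> A `<=` B -> m A <= m B.
Hypothesis mU_le : forall A B, closed A -> closed B -> m (A `|` B) <= m A + m B.
Hypothesis mU_ge : forall A B, closed A -> closed B -> A `&` B = set0 ->
  m A + m B <= m (A `|` B).
Hypothesis m_lty : m setT < +oo.

(** The hypotheses constrain [m] on closed sets only, so it is first extended to open sets from
    inside, then to all sets from outside. *)
Definition inner_content (U : set T) :=
  ereal_sup [set m K | K in [set K | closed K /\ K `<=` U]].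

Definition outer_content (A : set T) :=
  ereal_inf [set inner_content U | U in [set U | open U /\ A `<=` U]].

Let nT : normal_space T. Proof. exact: compact_normal. Qed.

Let m_ge0 A : closed A -> 0 <= m A.
Proof. by move=> cA; rewrite -m0; apply: le_m => //; exact: closed0. Qed.

Lemma content_fin_num A : closed A -> m A \is a fin_num.
Proof.
move=> cA; rewrite ge0_fin_numE ?m_ge0//; apply: le_lt_trans m_lty.
by apply: le_m => //; exact: closedT.
Qed.

Lemma le_inner_content (U V : set T) :
  U `<=` V -> inner_content U <= inner_content V.
Proof.
move=> UV; apply: ereal_sup_le => _ [K [cK KU] <-].
by exists K => //; split => //; exact: subset_trans UV.
Qed.

Lemma content_le_inner (K U : set T) :
  closed K -> K `<=` U -> m K <= inner_content U.
Proof. by move=> cK KU; apply: ereal_sup_ubound; exists K. Qed.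

Lemma inner_content_ge0 (U : set T) : 0 <= inner_content U.
Proof. by rewrite -m0; apply: content_le_inner => //; exact: closed0. Qed.

Lemma inner_content_lty (U : set T) : inner_content U < +oo.
Proof.
apply: le_lt_trans m_lty; apply: ge_ereal_sup => _ [K [cK _] <-].
by apply: le_m => //; exact: closedT.
Qed.

Lemma inner_contentU (U V : set T) : open U -> open V ->
  inner_content (U `|` V) <= inner_content U + inner_content V.
Proof.
move=> oU oV; apply: ge_ereal_sup => _ [K [cK KUV] <-].
have [A [B [cA cB AU BV ->]]] := normal_closed_setU nT cK oU oV KUV.
by apply: le_trans (mU_le cA cB) _; apply: leeD; exact: content_le_inner.
Qed.

(** A closed subset of the union is compact, hence inside a finite subunion, where finite
    subadditivity applies. *)
Lemma inner_content_bigcup (U : (set T)^nat) : (forall n, open (U n)) ->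
  inner_content (\bigcup_n U n) <= \sum_(i <oo) inner_content (U i).
Proof.
move=> oU; apply: ge_ereal_sup => _ [K [cK KU] <-].
pose V n := \big[setU/set0]_(i < n) U i.
have oV n : open (V n).
  by rewrite /V; elim/big_ind : _ => //; [exact: open0|exact: openU].
have [||||n KV] := @compact_nondecreasing_cover _ K V.
- exact: (subclosed_compact _ cT).
- exact: oV.
- by move=> i j ij; apply/subsetPset; exact: subset_bigsetU.
- move=> x /KU[i _ Uix]; exists i.+1 => //.
  by rewrite /V big_ord_recr; right.
apply: le_trans (content_le_inner cK KV) _.
apply: (@le_trans _ _ (\sum_(0 <= i < n) inner_content (U i))); last first.
  by apply: nneseries_lim_ge => i _ _; exact: inner_content_ge0.
rewrite big_mkord; elim: n {KV} => [|n IHn].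
  rewrite /V !big_ord0; apply: ge_ereal_sup => _ [A [_ A0] <-].
  by move: A0; rewrite subset0 => ->; rewrite m0.
rewrite /V !big_ord_recr/=; apply: le_trans (inner_contentU (oV n) (oU n)) _.
by rewrite leeD2r.
Qed.

Lemma outer_content_open (U : set T) :
  open U -> outer_content U = inner_content U.
Proof.
move=> oU; apply/eqP; rewrite eq_le; apply/andP; split.
  by apply: ereal_inf_lbound; exists U => //; split.
by apply: le_ereal_inf_tmp => _ [V [_ UV] <-]; exact: le_inner_content.
Qed.

Lemma outer_content_ge0 A : 0 <= outer_content A.
Proof.
by apply: le_ereal_inf_tmp => _ [V _ <-]; exact: inner_content_ge0.
Qed.

Lemma outer_content0 : outer_content set0 = 0.
Proof.
rewrite outer_content_open; last exact: open0.
apply/eqP; rewrite eq_le inner_content_ge0 andbT.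
by apply: ge_ereal_sup => _ [A [_ +] <-]; rewrite subset0 => ->; rewrite m0.
Qed.

Lemma le_outer_content : {homo outer_content : A B / A `<=` B >-> A <= B}.
Proof.
move=> A B AB; apply: ereal_inf_le_tmp => _ [U [oU BU] <-].
by exists U => //; split => //; exact: subset_trans BU.
Qed.

Lemma outer_content_lty A : outer_content A < +oo.
Proof.
apply: le_lt_trans (inner_content_lty setT); apply: ereal_inf_lbound.
by exists setT => //; split => //; exact: openT.
Qed.

Lemma outer_content_sigma_subadditive : sigma_subadditive outer_content.
Proof.
move=> F; apply/lee_addgt0Pr => e e0.
have fF n : outer_content (F n) \is a fin_num.
  by rewrite ge0_fin_numE ?outer_content_ge0 ?outer_content_lty.
(* The errors [e / 2 ^ n.+1] add up to [e] through [epsilon_trick]. *)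
have /choice[U UP] : forall n, exists U, [/\ open U, F n `<=` U &
    inner_content U <= outer_content (F n) + (e / (2 ^ n.+1)%:R)%:E].
  move=> n; have e2 : (0 < e / (2 ^ n.+1)%:R :> R)%R.
    by rewrite divr_gt0// ltr0n expn_gt0.
  have [_ [U [oU FU] <-] /ltW h] := lb_ereal_inf_adherent e2 (fF n).
  by exists U.
apply: (@le_trans _ _ (inner_content (\bigcup_n U n))).
  apply: ereal_inf_lbound; exists (\bigcup_n U n) => //; split.
    by apply: bigcup_open => n _; case: (UP n).
  by apply: subset_bigcup => n _; case: (UP n).
apply: le_trans (inner_content_bigcup _) _; first by move=> n; case: (UP n).
apply: le_trans (epsilon_trick xpredT _ _).
- apply: lee_nneseries => [n _ _|n _]; first exact: inner_content_ge0.
  by case: (UP n).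
- by move=> n; exact: outer_content_ge0.
- exact: ltW.
Qed.

Let mu : {outer_measure set T -> \bar R} :=
  HB.pack outer_content (isOuterMeasure.Build R T outer_content outer_content0
    outer_content_ge0 le_outer_content outer_content_sigma_subadditive).

(** The test set may be enlarged to an open [V]. A closed [K] in [V & U] nearly exhausts it; the
    open set [V \ K] contains [V \ U] and is nearly exhausted by a closed [K']. As [K] and [K'] are
    disjoint in [V], [mU_ge] bounds their total content by that of [V]. *)
Lemma open_caratheodory_content (U : set T) : open U ->
  outer_content.-caratheodory U.
Proof.
move=> oU; apply: (@le_caratheodory_measurable _ _ mu) => A /=.
apply: le_ereal_inf_tmp => _ [V [oV AV] <-].
apply: (@le_trans _ _ (outer_content (V `&` U) + outer_content (V `&` ~` U))).
  by apply: leeD; apply: le_outer_content; exact: setSI.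
rewrite outer_content_open; last exact: openI.
rewrite -leeBrDr; last first.
  by rewrite ge0_fin_numE ?outer_content_ge0 ?outer_content_lty.
apply: ge_ereal_sup => _ [K [cK KVU] <-].
rewrite leeBrDr; last first.
  by rewrite ge0_fin_numE ?outer_content_ge0 ?outer_content_lty.
rewrite addeC -leeBrDr ?content_fin_num//.
apply: (@le_trans _ _ (inner_content (V `\` K))).
  apply: ereal_inf_lbound; exists (V `\` K) => //; split.
    by rewrite setDE; apply: openI => //; exact: closed_openC.
  by move=> x [Vx nUx]; split => // /KVU[].
apply: ge_ereal_sup => _ [K' [cK' K'VK] <-].
rewrite leeBrDr ?content_fin_num//.
apply: le_trans (mU_ge cK' cK _) _.
  by apply/seteqP; split => // x [/K'VK[_ +] Kx].
apply: content_le_inner; first exact: closedU.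
by move=> x [/K'VK[]|/KVU[]].
Qed.

Lemma borel_caratheodory_content (A : set (borel T)) : measurable A ->
  outer_content.-caratheodory A.
Proof.
have : <<s @open T >> `<=` mu.-cara.-measurable.
  apply: smallest_sub; first exact: sigma_algebra_measurable.
  exact: open_caratheodory_content.
by move=> + mA; exact.
Qed.

Lemma outer_content_sigma_additive :
  semi_sigma_additive (outer_content : set (borel T) -> _).
Proof.
move=> F mF tF mUF.
apply: (@caratheodory_measure_sigma_additive _ _ mu) => //.
- by move=> n; exact: borel_caratheodory_content.
- exact: borel_caratheodory_content.
Qed.

(** The measure of [K] is an infimum over open [U] around [K] of inner contents, so a lower bound
    only needs one closed witness inside each [U]. Taking [K' = K] gives [m K <= mu K]. *)
Lemma content_extension : m setT = 1 -> exists mu : Prob R T,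
  forall K t, closed K ->
    (forall U, open U -> K `<=` U ->
       exists2 K', closed K' /\ K' `<=` U & t <= m K') ->
    t <= mu K.
Proof.
move=> m1.
have muT : outer_content [set: borel T] = 1.
  rewrite outer_content_open; last exact: openT.
  apply/eqP; rewrite eq_le -m1; apply/andP; split.
    apply: ge_ereal_sup => _ [K [cK _] <-].
    by apply: le_m => //; exact: closedT.
  by apply: content_le_inner => //; exact: closedT.
pose M := isMeasure.Build _ (borel T) R outer_content
  outer_content0 outer_content_ge0 outer_content_sigma_additive.
pose M1 : {measure set (borel T) -> \bar R} := HB.pack outer_content M.
pose P := Measure_isProbability.Build _ (borel T) R M1 muT.
pose mu' : Prob R T := HB.pack outer_content M P.
exists mu' => K t cK h.
apply: le_ereal_inf_tmp => _ [U [oU KU] <-].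
have [K' [cK' K'U] tK'] := h U oU KU.
by apply: le_trans tK' _; exact: content_le_inner.
Qed.

End content.

(** * Ultralimits of probability measures *)

Lemma ultra_compact_cvg (I : Type) (G : set_system I) (T : ptopologicalType)
    (K : set T) (u : I -> T) :
  UltraFilter G -> compact K -> (forall i, K (u i)) -> cvg (u @ G).
Proof.
move=> GU cK Ku; have [|p [_ up]] := cK (u @ G) _.
  exact: (@filterE _ G _ (u @^-1` K) Ku).
apply/cvg_ex; exists p => V pV.
have [//|GnV] := in_ultra_setVsetC (u @^-1` V) GU.
by have [x []] := up (~` V) V GnV pV.
Qed.

Lemma probability_fin_num_borel (R : realType) (X : ptopologicalType)
  (Q : Prob R X) (A : set (borel X)) : measurable A -> Q A \is a fin_num.
Proof. by move=> mA; exact: fin_num_measure. Qed.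

Lemma open_borel (X : ptopologicalType) (U : set X) :
  open U -> measurable (U : set (borel X)).
Proof. by move=> oU; exact: sub_gen_smallest. Qed.

Lemma closed_borel (X : ptopologicalType) (K : set X) :
  closed K -> measurable (K : set (borel X)).
Proof.
move=> cK; rewrite -(setCK K); apply: measurableC.
by apply: open_borel; exact: closed_openC.
Qed.

Section ultralimit.
Local Open Scope ereal_scope.
Context (R : realType) (X : ptopologicalType).
Hypotheses (hX : hausdorff_space X) (cX : compact [set: X]).
Context (G : set_system nat) (GU : UltraFilter G).

(** The content is the limit of [nu i A] along [G], which exists because the values stay in the
    compact interval from 0 to 1. Limits preserve monotonicity, subadditivity and additivity on
    disjoint closed sets. *)
Lemma ultralimit_closed (nu : nat -> Prob R X) : exists mu : Prob R X,
  forall K t, closed K ->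
    (forall U : set X, open U -> K `<=` U ->
       \forall i \near G, t%:E <= nu i U) ->
    t%:E <= mu K.
Proof.
pose v (A : set X) i := fine (nu i A).
have vE A i : measurable (A : set (borel X)) -> (v A i)%:E = nu i A.
  by move=> mA; rewrite /v fineK// probability_fin_num_borel.
pose m (A : set X) := (lim (v A @ G))%:E.
have cvgv A : closed A -> v A @ G --> lim (v A @ G).
  move=> /closed_borel mA.
  apply: (ultra_compact_cvg _ (@segment_compact _ 0%R 1%R)).
  move=> i /=; rewrite in_itv/= -!lee_fin vE// measure_ge0/=.
  exact: probability_le1.
have [||||||mu muP] := @content_extension R X hX cX m.
- rewrite /m (_ : v set0 = cst 0%R) ?lim_cst//.
  by apply/funext => i; rewrite /v measure0.
- move=> A B cA cB AB; rewrite lee_fin; apply: ler_lim; [exact: cvgv..|].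
  apply: nearW => i; rewrite -lee_fin !vE; try exact: closed_borel.
  by apply: le_measure; rewrite ?inE//; exact: closed_borel.
- move=> A B cA cB; rewrite lee_fin.
  have cAB : (v A + v B)%R @ G --> (lim (v A @ G) + lim (v B @ G))%R.
    by apply: cvgD; exact: cvgv.
  apply: (ler_cvg_to (cvgv _ (closedU cA cB)) cAB).
  apply: nearW => i /=; rewrite -lee_fin EFinD !vE; try exact: closed_borel.
    by apply: measureU2; exact: closed_borel.
  by apply: closed_borel; exact: closedU.
- move=> A B cA cB AB; rewrite lee_fin.
  have cAB : (v A + v B)%R @ G --> (lim (v A @ G) + lim (v B @ G))%R.
    by apply: cvgD; exact: cvgv.
  apply: (ler_cvg_to cAB (cvgv _ (closedU cA cB))).
  apply: nearW => i /=; rewrite -lee_fin EFinD !vE; try exact: closed_borel.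
    by rewrite measureU//; exact: closed_borel.
  by apply: closed_borel; exact: closedU.
- by rewrite ltry.
- rewrite /m (_ : v setT = cst 1%R) ?lim_cst//.
  by apply/funext => i; rewrite /v probability_setT.
exists mu => K t cK h; apply: muP => // U oU KU.
(* The hypothesis bounds masses of open sets while the content lives on closed ones; [V] and its
   closure, between [K] and [U], bridge the two. *)
have [V [oV KV VU]] := normal_closed_shrink (compact_normal hX cX) cK oU KU.
exists (closure V); first by split => //; exact: closed_closure.
rewrite lee_fin; apply: limr_ge.
  by apply/cvg_ex; eexists; apply: cvgv; exact: closed_closure.
near=> i; rewrite -lee_fin vE; last first.
  by apply: closed_borel; exact: closed_closure.
apply: (@le_trans _ _ (nu i V)); first by near: i; exact: h.
apply: le_measure; rewrite ?inE.
- exact: open_borel.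
- by apply: closed_borel; exact: closed_closure.
- exact: subset_closure.
Unshelve. all: by end_near. Qed.

(** The open-set inequality of the portmanteau theorem along [G], with a slack [e] in place of a
    lower limit. *)
Definition portmanteau (nu : nat -> Prob R X) (mu : Prob R X) :=
  forall (U : set X) (e : R), open U -> (0 < e)%R ->
    \forall i \near G, mu U <= nu i U + e%:E.

Lemma ultralimit_portmanteau (nu : nat -> Prob R X) : exists mu : Prob R X,
  forall rho : nat -> Prob R X,
  (forall K U (e : R), closed K -> open U -> K `<=` U -> (0 < e)%R ->
     \forall i \near G, rho i K <= nu i U + e%:E) ->
  portmanteau rho mu.
Proof.
have [mu muP] := ultralimit_closed nu.
exists mu => rho rhonu U e oU e0.
have [//|nG] := in_ultra_setVsetC [set i | mu U <= rho i U + e%:E] GU.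
pose K := ~` U; have cK : closed K by exact: open_closedC.
have mK := closed_borel cK.
have fK (Q : Prob R X) : Q K \is a fin_num by exact: probability_fin_num_borel.
have QU (Q : Prob R X) : Q U = 1 - Q K.
  by rewrite -probability_setC// /K setCK.
suff : (fine (mu K) + e / 2)%:E <= mu K.
  rewrite -[leRHS]fineK// lee_fin; lra.
apply: muP => // V oV KV.
have e20 : (0 < e / 2)%R by rewrite divr_gt0.
near=> i.
have /= /negP : (~` [set i | mu U <= rho i U + e%:E]) i by near: i.
rewrite -ltNge !QU => muK.
have rhoV : rho i K <= nu i V + (e / 2)%:E by near: i; exact: rhonu.
have fV : nu i V \is a fin_num.
  by apply: probability_fin_num_borel; exact: open_borel.
move: muK rhoV.
rewrite -(fineK (fK mu)) -(fineK (fK (rho i))) -(fineK fV).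
rewrite -!EFinB -!EFinD lte_fin !lee_fin; lra.
Unshelve. all: by end_near. Qed.

End ultralimit.

(** * Integrals of semicontinuous functions *)

Section staircase.
Local Open Scope ereal_scope.
Context (R : realType) (e : R) (e0 : (0 < e)%R).

(** Rounds [t], truncated at [n * e], down to a multiple of [e]. Composed with [g] it is a sum of
    indicators of superlevel sets, which are open for lower semicontinuous [g]. *)
Definition staircase (n : nat) (t : \bar R) : R :=
  (\sum_(k < n) e * ((k.+1%:R * e)%:E < t)%E%:R)%R.

Lemma staircase_ge0 n t : (0 <= staircase n t)%R.
Proof. by apply: sumr_ge0 => k _; rewrite mulr_ge0// ltW. Qed.

Lemma staircase_le n t : 0 <= t -> (staircase n t)%:E <= t.
Proof.
(* The second bound feeds the induction: when level [n.+1] is counted, [n.+1 * e < t] already. *)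
move=> t0; suff [] : (staircase n t)%:E <= t /\ (staircase n t <= n%:R * e)%R.
  by [].
rewrite /staircase; elim: n => [|n [IHt IHn]].
  by rewrite big_ord0 mul0r.
rewrite big_ord_recr/=; have [nt|_] := ltP; rewrite ?mulr1 ?mulr0 ?addr0.
  have h : (\sum_(k < n) e * ((k.+1%:R * e)%:E < t)%E%:R + e <= n.+1%:R * e)%R.
    by rewrite -natr1 mulrDl mul1r lerD2r.
  by split => //; apply: le_trans (ltW nt); rewrite lee_fin.
split => //; apply: le_trans IHn _.
by rewrite ler_pM2r// ler_nat.
Qed.

Lemma le_staircase n t (h : R) :
  h%:E <= t -> (h <= n%:R * e)%R -> (h <= staircase n t + e)%R.
Proof.
move=> ht hn.
(* Either some level was missed, and the sum is already within [e] of [h], or all [n] levels were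
   counted. *)
suff : (h <= staircase n t + e)%R \/ staircase n t = (n%:R * e)%R.
  by case=> // ->; rewrite (le_trans hn)// lerDl ltW.
rewrite {hn}/staircase; elim: n => [|n [IH|IH]].
- by right; rewrite big_ord0 mul0r.
- left; rewrite big_ord_recr/=; apply: le_trans IH _.
  by rewrite lerD2r lerDl mulr_ge0// ltW.
- rewrite big_ord_recr/= IH; have [nt|nt] := ltP; rewrite ?mulr1 ?mulr0 ?addr0.
    by right; rewrite -natr1 mulrDl mul1r.
  left; rewrite -lee_fin; apply: le_trans ht (le_trans nt _).
  by rewrite lee_fin -natr1 mulrDl mul1r.
Qed.

End staircase.

Section lower_semicontinuous_integral.
Local Open Scope ereal_scope.
Context (R : realType) (X : ptopologicalType).

Lemma lower_semicontinuous_borel (g : X -> \bar R) :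
  lower_semicontinuous g ->
  measurable_fun [set: borel X] (g : borel X -> \bar R).
Proof.
move=> /lower_semicontinuousP og.
apply: (measurability _ (ErealGenOInfty.measurableE R)) => _ [_ [a ->] <-].
apply: measurableI => //.
by rewrite preimage_itvoy; apply: (@open_borel X); exact: og.
Qed.

Lemma integral_staircase (Q : Prob R X) (g : X -> \bar R) (e : R) n :
  lower_semicontinuous g -> (0 < e)%R ->
  \int[Q]_x (staircase e n (g x))%:E =
    \sum_(k < n) e%:E * Q [set x | (k.+1%:R * e)%:E < g x].
Proof.
move=> lg e0.
pose U (k : nat) : set (borel X) := [set x | (k.+1%:R * e)%:E < g x].
have mU k : measurable (U k).
  by apply: (@open_borel X); move/lower_semicontinuousP : lg; exact.
have mf (k : 'I_n) : measurable_fun [set: borel X]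
    (fun x => (e * \1_(U k) x)%:E).
  apply/measurable_EFinP; apply: measurable_funM; first exact: measurable_cst.
  exact: measurable_indic.
transitivity (\int[Q]_x (\sum_(k < n) (e * \1_(U k) x)%:E)).
  apply: eq_integral => x _; rewrite /staircase sumEFin; congr EFin.
  apply: eq_bigr => k _; rewrite indicE; congr (e * _%:R)%R.
  by congr (nat_of_bool _); apply/esym; apply/idP/idP; rewrite inE.
rewrite ge0_integral_sum//; last first.
  by move=> k x _; rewrite lee_fin mulr_ge0// ltW.
apply: eq_bigr => k _.
rewrite (@integralZl_indic _ (borel X) R Q setT measurableT (fun=> U k))//.
- by rewrite integral_indic// ?setIT.
- by move=> e0'; exfalso; lra.
Qed.

Lemma staircase_borel (g : X -> \bar R) (e : R) n :
  lower_semicontinuous g ->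
  measurable_fun [set: borel X] (fun x => (staircase e n (g x))%:E).
Proof.
move=> /lower_semicontinuousP og; apply/measurable_EFinP.
apply: measurable_sum => k; apply: measurable_funM; first exact: measurable_cst.
pose U : set (borel X) := [set x | (k.+1%:R * e)%:E < g x].
rewrite [X in measurable_fun _ X](_ : _ = \1_U).
  by apply: measurable_indic; apply: (@open_borel X); exact: og.
apply/funext => x; rewrite indicE; congr (_%:R); congr (nat_of_bool _).
by apply/esym; apply/idP/idP; rewrite inE.
Qed.

Context (G : set_system nat) (GU : UltraFilter G).

Import HBNNSimple.

(** A simple [h <= g] is bounded, so up to [d] it lies below a staircase of [g] with finitely many
    levels. Each level set is open, and one index [i] handles them all. *)
Lemma portmanteau_integral_le (nu : nat -> Prob R X) (mu : Prob R X)
    (g : X -> \bar R) (b : R) :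
  portmanteau G nu mu -> lower_semicontinuous g -> (forall x, 0 <= g x) ->
  (\forall i \near G, \int[nu i]_x g x <= b%:E) ->
  \int[mu]_x g x <= b%:E.
Proof.
move=> pm lg g0 gb.
rewrite ge0_integralTE//; apply: ge_ereal_sup => _ [h /= hg <-].
apply/lee_addgt0Pr => e e0.
pose d := (e / 2)%R; have d0 : (0 < d)%R by rewrite divr_gt0.
have [M hM] : exists M : R, forall x, (h x <= M)%R.
  have [M [Mr MP]] := simple_bounded h.
  exists (M + 1)%R => x; apply: le_trans (ler_norm _) _.
  by apply: MP => //; rewrite ltrDl.
pose n := (Num.truncn (`|M| / d)).+1.
have Mn : (M <= n%:R * d)%R.
  rewrite -ler_pdivrMr//; apply/ltW.
  apply: le_lt_trans (truncnS_gt _).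
  by rewrite ler_pM2r ?invr_gt0// ler_norm.
pose U k := [set x | (k.+1%:R * d)%:E < g x].
have oU k : open (U k) by move/lower_semicontinuousP : lg; exact.
near G => i.
(* The [n] errors [1 / n], weighted by [d], cost [d] in total; with the rounding error this makes
   [e]. *)
have muU : forall k : 'I_n, mu (U k) <= nu i (U k) + (n%:R^-1)%:E.
  near: i; apply: filter_forall => k.
  by apply: pm => //; rewrite invr_gt0 ltr0n.
rewrite -integralT_nnsfun.
apply: (@le_trans _ _ (\int[mu]_x ((staircase d n (g x))%:E + d%:E))).
  apply: ge0_le_integral => //.
  - by move=> x _; rewrite lee_fin fun_ge0.
  - by apply/measurable_EFinP.
  - by apply: emeasurable_funD => //; exact: staircase_borel.
  - move=> x _; rewrite -EFinD lee_fin; apply: le_staircase => //.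
    by apply: le_trans Mn.
rewrite ge0_integralD//; last 3 first.
- by move=> x _; rewrite lee_fin staircase_ge0// ltW.
- exact: staircase_borel.
- by move=> x _; rewrite lee_fin ltW.
rewrite integral_cst// [X in _ * X]probability_setT mule1.
rewrite integral_staircase//.
apply: (@le_trans _ _
    (\sum_(k < n) d%:E * (nu i (U k) + (n%:R^-1)%:E) + d%:E)).
  rewrite leeD2r//; apply: lee_sum => k _.
  by apply: lee_wpmul2l; [rewrite lee_fin ltW|exact: muU].
apply: (@le_trans _ _ (\sum_(k < n) d%:E * nu i (U k) + e%:E)).
  under eq_bigr do rewrite ge0_muleDr//.
  rewrite big_split/= -addeA leeD2l//.
  rewrite sumEFin sumr_const card_ord -EFinD lee_fin.
  rewrite -[X in (X + _)%R]mulr_natr divfK ?pnatr_eq0// /d; lra.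
rewrite leeD2r// -integral_staircase//.
apply: (@le_trans _ _ (\int[nu i]_x g x)); last by near: i.
apply: ge0_le_integral => //.
- by move=> x _; rewrite lee_fin staircase_ge0// ltW.
- exact: staircase_borel.
- exact: lower_semicontinuous_borel.
- by move=> x _; exact: staircase_le.
Unshelve. all: by end_near. Qed.

End lower_semicontinuous_integral.

(** * Upper semicontinuous integrands and weak neighborhoods *)

Section upper_semicontinuous_integral.
Local Open Scope ereal_scope.
Context (R : realType) (X : ptopologicalType).
Hypothesis cX : compact [set: X].

Lemma upper_semicontinuous_bounded (L : X -> \bar R) :
  upper_semicontinuous L -> (forall x, L x < +oo) ->
  exists2 M : R, (0 <= M)%R & forall x, L x <= M%:E.
Proof.
move=> uL Loo; have [|m n mn||n nL] :=
  @compact_nondecreasing_cover _ setT (fun n => [set x | L x < n%:R%:E]) cX.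
- move=> n; rewrite openE => x /uL[V Vx VL]; rewrite /interior.
  exact: filterS Vx.
- apply/subsetPset => x /= /lt_le_trans; apply.
  by rewrite lee_fin ler_nat.
- move=> x _; have := Loo x; case Lx : (L x) => [r|//|] _; last first.
    by exists 0%N => //=; rewrite Lx ltNyr.
  by exists (Num.truncn r).+1 => //=; rewrite Lx lte_fin truncnS_gt.
- by exists n%:R => // x; exact/ltW/nL.
Qed.

(** Reduces to the nonnegative lower semicontinuous function [M - L], also when [L] or its integral
    takes the value [-oo]. *)
Lemma integral_upper_semicontinuous (L : X -> \bar R) (M : R) :
  upper_semicontinuous L -> (0 <= M)%R -> (forall x, L x <= M%:E) ->
  lower_semicontinuous (fun x => M%:E - L x) /\
  (forall Q : Prob R X, \int[Q]_x L x = M%:E - \int[Q]_x (M%:E - L x)).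
Proof.
move=> uL M0 LM.
have lg : lower_semicontinuous (fun x => M%:E - L x).
  move=> x a aL.
  have [|V Vx VL] := uL x (M - a)%R.
    move: aL; case: (L x) => [r||]//=;
      by rewrite -?EFinB ?lte_fin ?ltNyr//; lra.
  exists V => // y /VL.
  case: (L y) => [r||]//=; last by rewrite addey// ltry.
  by rewrite -EFinB !lte_fin; lra.
split=> // Q.
have g0 x : 0 <= M%:E - L x.
  by rewrite sube_ge0 ?LM// orbT.
have mg := lower_semicontinuous_borel lg.
have mL : measurable_fun [set: borel X] (L : borel X -> \bar R).
  rewrite (_ : L = fun x => M%:E - (M%:E - L x)); last first.
    apply/funext => x; have := LM x.
    by case: (L x) => [r||]//= _; rewrite -!EFinD; congr EFin; lra.
  by apply: emeasurable_funB => //; exact: measurable_cst.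
rewrite integralE.
have mp := measurable_funepos mL; have mn := measurable_funeneg mL.
have pM : \int[Q]_x L^\+ x <= M%:E.
  apply: (@le_trans _ _ (\int[Q]_x (cst M%:E) x)).
    apply: ge0_le_integral => // x _.
    by rewrite funeposE ge_max LM lee_fin.
  by rewrite integral_cst// [X in _ * X]probability_setT mule1.
have p0 : 0 <= \int[Q]_x L^\+ x by apply: integral_ge0.
have n0 : 0 <= \int[Q]_x L^\- x by apply: integral_ge0.
have I0 : 0 <= \int[Q]_x (M%:E - L x) by apply: integral_ge0.
(* All four terms are nonnegative, so both sides split; the integral of [L^\+] is finite and can be
   subtracted. *)
have : \int[Q]_x (M%:E + L^\- x) = \int[Q]_x ((M%:E - L x) + L^\+ x).
  apply: eq_integral => x _; have := LM x; rewrite funeposE funenegE.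
  case: (L x) => [r||]//=; rewrite ?lee_fin => rM.
    rewrite -!EFin_max -!EFinD; congr EFin.
    have [r0|r0] := leP 0%R r; last by rewrite max_l; lra.
    by rewrite max_r ?oppr_le0//; lra.
  by rewrite maxye maxNye adde0.
rewrite ge0_integralD// [in X in _ = X -> _]ge0_integralD//.
rewrite integral_cst// [X in _ * X]probability_setT mule1.
move: pM p0 n0 I0.
case: (\int[Q]_x L^\+ x) => [A||]//; case: (\int[Q]_x L^\- x) => [B||]//;
  case: (\int[Q]_x (M%:E - L x)) => [I||]//=.
by rewrite !lee_fin => _ _ _ _ [] ?; rewrite -!EFinB; congr EFin; lra.
Qed.

Context (G : set_system nat) (GU : UltraFilter G).
Context (nu : nat -> Prob R X) (mu : Prob R X) (pm : portmanteau G nu mu).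

Lemma portmanteau_integral_lt (L : X -> \bar R) (a : R) :
  upper_semicontinuous L -> (forall x, L x < +oo) ->
  \int[mu]_x L x < a%:E -> \forall i \near G, \int[nu i]_x L x < a%:E.
Proof.
move=> uL Loo.
have [M M0 LM] := upper_semicontinuous_bounded uL Loo.
have [lg intL] := integral_upper_semicontinuous uL M0 LM.
rewrite intL => aL.
have [//|nG] := in_ultra_setVsetC [set i | \int[nu i]_x L x < a%:E] GU.
exfalso; move: aL; apply/negP; rewrite -leNgt.
suff : \int[mu]_x (M%:E - L x) <= (M - a)%:E.
  case: (\int[mu]_x (M%:E - L x)) => [I||]//=.
    by rewrite -EFinB !lee_fin; lra.
  by rewrite leey.
apply: (portmanteau_integral_le GU pm lg).
  by move=> x; rewrite sube_ge0 ?LM// orbT.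
apply: filterS nG => i /= /negP; rewrite -leNgt intL.
case: (\int[nu i]_x (M%:E - L x)) => [I||]//=; last by rewrite leNye.
by rewrite -EFinB !lee_fin; lra.
Qed.

(** Both [f] and [- f] are upper semicontinuous; [portmanteau_integral_lt] for each gives the two
    sides. *)
Lemma portmanteau_weak_cvg (f : X -> R) (e : R) :
  bounded_continuous f -> (0 < e)%R ->
  \forall i \near G, `| \int[nu i]_x (f x)%:E - \int[mu]_x (f x)%:E | < e%:E.
Proof.
move=> [cf [M fM]] e0.
have uf (h : X -> R) : continuous h -> upper_semicontinuous (EFin \o h).
  move=> ch x a; rewrite lte_fin => hxa.
  exists (h @^-1` [set y | y < a]%R); last by move=> y; rewrite /= lte_fin.
  by apply: ch; exact: lt_nbhsl.
pose N := Num.max 0%R M.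
have intf (Q : Prob R X) : Q.-integrable setT (EFin \o (f : borel X -> R)).
  apply: measurable_bounded_integrable => //.
  - by apply: le_lt_trans (probability_le1 _ _) _ => //; rewrite ltry.
  - have [||lg _] := integral_upper_semicontinuous (M := N) (uf _ cf).
    + by rewrite le_max lexx.
    + move=> x; rewrite lee_fin le_max (le_trans (ler_norm _) (fM x))//.
      by rewrite orbT.
    have := lower_semicontinuous_borel lg => mg.
    apply/measurable_EFinP.
    rewrite (_ : _ \o _ = fun x => N%:E - (N%:E - (f x)%:E)).
      by apply: emeasurable_funB => //; exact: measurable_cst.
    by apply/funext => x /=; rewrite -!EFinB opprB addrC subrK.
  - exists M; split; first exact: num_real.
    by move=> y My x _ /=; apply: le_trans (fM x) (ltW My).
have fin (Q : Prob R X) := integrable_fin_num measurableT (intf Q).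
have intN (Q : Prob R X) :
    \int[Q]_x (EFin \o (fun x => - f x)%R) x = - (\int[Q]_x (f x)%:E).
  exact: (integralN (integrable_add_def measurableT (intf Q))).
near=> i.
have up : \int[nu i]_x (f x)%:E < (fine (\int[mu]_x (f x)%:E) + e)%:E.
  near: i; apply: (@portmanteau_integral_lt (EFin \o f)) => //.
  - exact: uf.
  - by move=> x; rewrite ltry.
  - by rewrite EFinD fineK ?fin// lteDl// ?lte_fin ?fin.
have dn : - (\int[nu i]_x (f x)%:E) < (- fine (\int[mu]_x (f x)%:E) + e)%:E.
  rewrite -intN; near: i.
  apply: (@portmanteau_integral_lt (EFin \o (fun x => - f x)%R)) => //.
  - by apply: uf => x; apply: continuousN; exact: cf.
  - by move=> x; rewrite ltry.
  - by rewrite intN EFinD EFinN fineK ?fin// lteDl// ?lte_fin ?fin_numN ?fin.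
move: up dn.
rewrite -(fineK (fin (nu i))) -(fineK (fin mu)) /=.
rewrite !lte_fin => up dn.
by rewrite ltr_norml; apply/andP; split; lra.
Unshelve. all: by end_near. Qed.

Lemma portmanteau_weak_open (V : set (Prob R X)) :
  weak_open V -> V mu -> \forall i \near G, V (nu i).
Proof.
move=> oV /oV[n [f [e [e0 [bf fV]]]]].
have : \forall i \near G, forall k : 'I_n,
    `| \int[nu i]_x (f k x)%:E - \int[mu]_x (f k x)%:E | < e%:E.
  by apply: filter_forall => k; exact: portmanteau_weak_cvg.
by apply: filterS => i; exact: fV.
Qed.

End upper_semicontinuous_integral.

(** * Couplings *)

(** Suits both limits of the theorem, where the lower bound is immediate and only eventual upper
    bounds need work. *)
Lemma ereal_cvg_from_above (R : realType) (T : Type) (F : set_system T)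
    (f : T -> \bar R) (l : \bar R) : Filter F ->
  (\forall x \near F, l <= f x)%E ->
  (forall a : R, (l < a%:E)%E -> \forall x \near F, (f x <= a%:E)%E) ->
  f x @[x --> F] --> l.
Proof.
move=> FF lf; case: l lf => [r||] lf fl A.
- move=> /nbhs_normP[e /= e0 eA].
  have re : (r%:E < (r + e / 2)%:E)%E by rewrite lte_fin ltrDl divr_gt0.
  have := fl _ re; move: lf; apply: filterS2 => x rf fa; rewrite /preimage/=.
  move: rf fa; case: (f x) => [y||]//=; rewrite !lee_fin => ry yr.
  by apply: eA; rewrite /ball_/= ltr_norml; apply/andP; split; lra.
- move=> [M [_ MA]]; apply: filterS lf => x; rewrite leye_eq => /eqP fx.
  by apply: MA; rewrite fx ltry.
- move=> [M [_ MA]]; have := fl (M - 1)%R (ltNyr _).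
  apply: filterS => x fx; apply: MA; apply: le_lt_trans fx _.
  by rewrite lte_fin; lra.
Qed.

Section coupling.
Local Open Scope ereal_scope.
Context (R : realType) (X : ptopologicalType).

Import HBNNSimple.

(* Only simple functions below [g] are integrated, so [g] itself need not be
   measurable. *)
Lemma integral_ge_indic d (T : measurableType d)
    (mu : {measure set T -> \bar R}) (A : set T) (t : R) (g : T -> \bar R) :
  measurable A -> (0 <= t)%R -> (forall x, 0 <= g x) ->
  (forall x, A x -> t%:E <= g x) -> t%:E * mu A <= \int[mu]_x g x.
Proof.
move=> mA t0 g0 tg; rewrite ge0_integralTE//.
apply: ereal_sup_ubound; exists (scale_nnsfun (indic_nnsfun R mA) t0).
  move=> x; rewrite /= mindicE; have [xA|xA] := boolP (x \in A).
    by rewrite mulr1; apply: tg; rewrite inE in xA.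
  by rewrite mulr0.
rewrite -integralT_nnsfun/=.
rewrite (@integralZl_indic _ T R mu setT measurableT (fun=> A))//.
  by rewrite integral_indic// setIT.
by move=> t0'; exfalso; lra.
Qed.

(** Since [g] is not assumed measurable, the change of variables is made on the simple functions
    below [g], which vanish along [f]. *)
Lemma integral_pushforward_eq0 d1 d2 (T1 : measurableType d1)
    (T2 : measurableType d2) (Q : probability T1 R) (f : {mfun T1 >-> T2})
    (g : T2 -> \bar R) :
  (forall x, 0 <= g x) -> (forall x, g (f x) = 0) ->
  \int[distribution Q f]_x g x = 0.
Proof.
move=> g0 gf; apply/eqP; rewrite eq_le integral_ge0// andbT.
rewrite ge0_integralTE//; apply: ge_ereal_sup => _ [h /= hg <-].
rewrite -integralT_nnsfun ge0_integral_distribution//.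
- rewrite integral0_eq// => x _ /=; apply/eqP; rewrite eq_le.
  by rewrite [X in _ && X]lee_fin fun_ge0 andbT -[leRHS](gf x).
- exact/measurable_EFinP.
- by move=> y; rewrite lee_fin fun_ge0.
Qed.

Lemma OTcost_self_le0 (Q : Prob R X) (g : X * X -> \bar R) :
  (forall z, 0 <= g z) -> (forall x, g (x, x) = 0) -> OTcost g Q Q <= 0.
Proof.
move=> g0 gd.
have mdiag : measurable_fun [set: borel X] (fun x : borel X => (x, x)).
  by apply: measurable_fun_pair; exact: measurable_id.
pose diag : {mfun borel X >-> (borel X * borel X)%type} :=
  HB.pack (fun x : borel X => (x, x)) (isMeasurableFun.Build _ _ _ _ _ mdiag).
apply: ereal_inf_lbound; exists (distribution Q diag : probability _ _).
  move=> A mA; split; congr (Q _); apply/seteqP; split => x //=; by case.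
exact: integral_pushforward_eq0.
Qed.

Lemma scale_cost_ge0 (c : X * X -> \bar R) (r : R) :
  (0 <= r)%R -> (forall z, 0 <= c z) -> forall z, 0 <= scale_cost r c z.
Proof. by move=> r0 c0 z; rewrite mule_ge0. Qed.

Lemma OTcost_ge0 (c : X * X -> \bar R) (mu nu : Prob R X) :
  (forall z, 0 <= c z) -> 0 <= OTcost c mu nu.
Proof.
by move=> c0; apply: le_ereal_inf_tmp => _ [pi _ <-]; exact: integral_ge0.
Qed.

Lemma Dc_le (D : Prob R X -> Prob R X -> \bar R) (c : X * X -> \bar R)
    (Q P : Prob R X) :
  (forall z, 0 <= c z) -> (forall x, c (x, x) = 0) -> Dc D c Q P <= D Q P.
Proof.
move=> c0 cd; apply: (@le_trans _ _ (D Q P + OTcost c Q Q)).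
  by apply: ereal_inf_lbound; exists Q.
by rewrite -[leRHS]adde0 leeD2l// OTcost_self_le0.
Qed.

(** Mass arriving in [K] starts either in [U] or outside it. *)
Lemma coupling_le (mu nu : Prob R X)
    (pi : probability (borel X * borel X)%type R) (K U : set X) :
  coupling mu nu pi -> closed K -> open U -> nu K <= mu U + pi (~` U `*` K).
Proof.
move=> cpi cK oU.
have mK := closed_borel cK; have mU := open_borel oU.
rewrite -(cpi K mK).2 -(cpi U mU).1.
have mUT : measurable ((U : set (borel X)) `*` [set: borel X]).
  exact: measurableX.
have mUK : measurable (~` (U : set (borel X)) `*` (K : set (borel X))).
  by apply: measurableX => //; exact: measurableC.
apply: le_trans (measureU2 _ _ _) => //.
apply: le_measure; rewrite ?inE//.
- exact: measurableX.
- exact: measurableU.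
- move=> [x y] [_ /= Ky]; have [Ux|nUx] := pselect (U x); first by left.
  by right.
Qed.

(** The open sets where [c] exceeds [1 / n.+1] increase and cover [B], so one of them contains
    it. *)
Lemma lower_semicontinuous_gt0_compact (c : X * X -> \bar R)
    (B : set (X * X)) :
  lower_semicontinuous c -> compact B -> (forall z, B z -> 0 < c z) ->
  exists2 d : R, (0 < d)%R & forall z, B z -> d%:E <= c z.
Proof.
move=> /lower_semicontinuousP oc cB Bc.
have [||x Bx|n nB] := @compact_nondecreasing_cover _ B
  (fun n => [set z | (n.+1%:R^-1)%:E < c z]) cB.
- by move=> n; exact: oc.
- move=> m n mn; apply/subsetPset => z /=; apply: le_lt_trans.
  by rewrite lee_fin lef_pV2 ?posrE ?ltr0n// ler_nat.
- have := Bc _ Bx; case cx : (c x) => [t||]//= t0; last first.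
    by exists 0%N => //=; rewrite cx ltry.
  rewrite lte_fin in t0; exists (Num.truncn t^-1) => //=.
  rewrite cx lte_fin -[ltRHS]invrK ltf_pV2 ?posrE ?invr_gt0 ?ltr0n//.
  exact: truncnS_gt.
- exists (n.+1%:R^-1)%R; first by rewrite invr_gt0 ltr0n.
  by move=> z /nB /ltW.
Qed.

End coupling.

(** * Worst cases *)

Section worst_case.
Local Open Scope ereal_scope.
Context (R : realType) (X : ptopologicalType).
Hypotheses (hX : hausdorff_space X) (cX : compact [set: X]).
Variables (P : Prob R X) (D : Prob R X -> Prob R X -> \bar R).
Variable c : X * X -> \bar R.
Hypothesis D0 : forall mu nu, 0 <= D mu nu.
Hypothesis lD : weak_lsc (fun Q => D Q P).
Hypothesis c0 : forall z, 0 <= c z.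
Hypothesis lc : lower_semicontinuous c.
Hypothesis c_eq0 : forall x y : X, c (x, y) = 0 <-> x = y.
Variable eps : R.

(** The easy half: [Dc_le] makes the feasible set for the transport-regularized divergence
    larger. *)
Lemma worst_case_le_scale (L : X -> \bar R) (r : R) : (0 <= r)%R ->
  worst_case D P eps L <= worst_case (Dc D (scale_cost r c)) P eps L.
Proof.
move=> r0; apply: ereal_sup_le => _ [Q /= DQ <-].
exists Q => //=; apply: le_trans DQ; apply: Dc_le.
  exact: scale_cost_ge0.
by move=> x; rewrite /scale_cost (c_eq0 x x).2 // mule0.
Qed.

(** The slack [e] replaces attainment of the two infima; both summands being nonnegative, each obeys
    the bound on the sum. *)
Lemma Dc_coupling (Q : Prob R X) (r e : R) :
  (0 <= r)%R -> (0 < e)%R -> Dc D (scale_cost r c) Q P <= eps%:E ->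
  exists (eta : Prob R X) (pi : probability (borel X * borel X)%type R),
    [/\ D eta P <= (eps + e)%:E, coupling eta Q pi &
        \int[pi]_z scale_cost r c z <= (eps + e)%:E].
Proof.
move=> r0 e0 DQ.
have : Dc D (scale_cost r c) Q P < (eps + e)%:E.
  by apply: le_lt_trans DQ _; rewrite lte_fin ltrDl.
move=> /ereal_inf_lt[_ [eta _ <-] h].
have OT0 := OTcost_ge0 eta Q (scale_cost_ge0 r0 c0).
have : OTcost (scale_cost r c) eta Q < (eps + e)%:E.
  by apply: le_lt_trans h; rewrite leeDr.
move=> /ereal_inf_lt[_ [pi cpi <-] /ltW hpi].
exists eta, pi; split => //.
by apply/ltW; apply: le_lt_trans h; rewrite leeDl.
Qed.

Context (G : set_system nat) (GU : UltraFilter G).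
Hypothesis Goo : \oo `<=` G.

(* Off the diagonal the cost is bounded below on compact sets, so a bounded
   transport budget at price [r i -> +oo] moves a vanishing amount of mass out
   of a neighborhood of a closed set. *)
Lemma coupling_near (eta Q : nat -> Prob R X)
    (pi : nat -> probability (borel X * borel X)%type R)
    (r : nat -> R) (B : R) :
  (forall i, coupling (eta i) (Q i) (pi i)) ->
  (forall i, i.+1%:R <= r i)%R ->
  (forall i, \int[pi i]_z scale_cost (r i) c z <= B%:E) ->
  forall (K U : set X) (e : R),
  closed K -> open U -> K `<=` U -> (0 < e)%R ->
    \forall i \near G, Q i K <= eta i U + e%:E.
Proof.
move=> cpi ri piB K U e cK oU KU e0.
have cUK : compact (~` U `*` K).
  apply: compact_setX; apply: (subclosed_compact _ cX) => //.
  exact: open_closedC.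
have [|d d0 dc] := lower_semicontinuous_gt0_compact lc cUK.
  move=> [x y] [/= nUx Ky]; rewrite lt0e c0 andbT; apply/eqP => /c_eq0 xy.
  by apply: nUx; apply: KU; rewrite xy.
(* From this index on [B <= r i * d * e], while the transported mass times [r i * d] is at most
   [B]. *)
apply: Goo; exists (Num.truncn (B / (d * e))) => // i /= Bi.
apply: le_trans (coupling_le (cpi i) cK oU) _; rewrite leeD2l//.
have r0 : (0 < r i)%R by apply: lt_le_trans (ri i); rewrite ltr0n.
have mUK : measurable (~` (U : set (borel X)) `*` (K : set (borel X))).
  apply: measurableX; last exact: closed_borel.
  by apply: measurableC; exact: open_borel.
have rd0 : (0 < r i * d)%R by exact: mulr_gt0.
have : (r i * d)%:E * pi i (~` U `*` K) <= B%:E.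
  apply: le_trans (piB i); apply: integral_ge_indic => //.
  - exact: ltW.
  - exact/scale_cost_ge0/c0/ltW.
  - move=> z /dc dz; rewrite EFinM; apply: lee_wpmul2l => //.
    by rewrite lee_fin ltW.
have fpi : pi i (~` U `*` K) \is a fin_num by exact: fin_num_measure.
rewrite -(fineK fpi) -EFinM !lee_fin => piBi.
rewrite -(ler_pM2l rd0); apply: (le_trans piBi).
have : (B / (d * e) <= i.+1%:R)%R.
  apply/ltW/(lt_le_trans (truncnS_gt _)).
  by rewrite ler_nat ltnS.
rewrite ler_pdivrMr ?mulr_gt0// => /le_trans; apply.
by rewrite mulrA ler_pM2r// ler_pM2r.
Qed.

Lemma worst_case_cvg_le (L : X -> \bar R) (a : R) :
  upper_semicontinuous L -> (forall x, L x < +oo) ->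
  worst_case D P eps L < a%:E ->
  \forall r \near +oo%R, worst_case (Dc D (scale_cost r c)) P eps L <= a%:E.
Proof.
move=> uL Loo WL; apply: contrapT => nW.
(* If no such tuple existed for some [n], every feasible [Q] at every [r >= n.+1] would have
   expectation at most [a], against [nW]. The divergence tolerance must vanish; for the transport
   cost a fixed budget suffices. *)
have /choice[s sP] : forall n, exists s : (R * Prob R X * Prob R X *
    probability (borel X * borel X)%type R)%type,
    let: (r, eta, Q, pi) := s in
    [/\ (n.+1%:R <= r)%R, a%:E < \int[Q]_x L x,
        D eta P <= (eps + n.+1%:R^-1)%:E, coupling eta Q pi &
        \int[pi]_z scale_cost r c z <= (eps + 1)%:E].
  move=> n; apply: contrapT => nP; apply: nW.
  near=> r; apply: ge_ereal_sup => _ [Q /= DQ <-].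
  have nr : (n.+1%:R <= r)%R by near: r; exact: nbhs_pinfty_ge.
  have r0 : (0 <= r)%R by apply: le_trans nr.
  have n1 : (0 < n.+1%:R^-1 :> R)%R by rewrite invr_gt0 ltr0n.
  have [eta [pi [De cpi hpi]]] := Dc_coupling r0 n1 DQ.
  rewrite leNgt; apply/negP => aL; apply: nP; exists (r, eta, Q, pi).
  split => //; apply: le_trans hpi _; rewrite lee_fin lerD2l.
  by rewrite invf_le1 ?ltr0n// ler1n.
pose r n := (s n).1.1.1; pose eta n := (s n).1.1.2.
pose Q n := (s n).1.2; pose pi n := (s n).2.
have {}sP n : [/\ (n.+1%:R <= r n)%R, a%:E < \int[Q n]_x L x,
    D (eta n) P <= (eps + n.+1%:R^-1)%:E, coupling (eta n) (Q n) (pi n) &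
    \int[pi n]_z scale_cost (r n) c z <= (eps + 1)%:E].
  by have := sP n; rewrite /r /eta /Q /pi; case: (s n) => [[[? ?] ?] ?].
have [mu muP] := ultralimit_portmanteau hX cX GU eta.
have muQ : portmanteau G Q mu.
  apply: muP; apply: (@coupling_near _ _ pi r (eps + 1)) => i;
    by case: (sP i).
have mueta : portmanteau G eta mu.
  apply: muP => K U e cK oU KU e0; apply: nearW => i.
  apply: (@le_trans _ _ (eta i U)); last by rewrite leeDl// lee_fin ltW.
  by apply: le_measure; rewrite ?inE//; [exact: closed_borel|exact: open_borel].
(* Otherwise [eta i] would lie in the weakly open set where the divergence exceeds [eps + e] for
   [G]-many [i], against the bound [eps + 1 / i.+1]. *)
have Dmu : D mu P <= eps%:E.
  apply/lee_addgt0Pr => e e0; rewrite leNgt; apply/negP => De.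
  have Geta := portmanteau_weak_open cX GU mueta (lD (a := (eps + e)%R)) De.
  have Ge : \forall i \near G, (i.+1%:R^-1 < e)%R.
    apply: Goo; exists (Num.truncn e^-1) => // i /= ei.
    rewrite -[ltRHS]invrK ltf_pV2 ?posrE ?invr_gt0 ?ltr0n//.
    by apply: lt_le_trans (truncnS_gt _) _; rewrite ler_nat ltnS.
  have [i [/= Di ie]] := filter_ex (filterI Geta Ge).
  have [_ _ + _ _] := sP i; apply/negP; rewrite -ltNge.
  by apply: le_lt_trans Di; rewrite lee_fin lerD2l ltW.
have muL : \int[mu]_x L x < a%:E.
  by apply: le_lt_trans WL; apply: ereal_sup_ubound; exists mu.
have [i /= Qi] := filter_ex (portmanteau_integral_lt cX GU muQ uL Loo muL).
by have [_ aQ _ _ _] := sP i; have := lt_trans Qi aQ; rewrite ltxx.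
Unshelve. all: by end_near. Qed.

End worst_case.

Theorem theorem9 (R : realType) (X : pseudoPMetricType R)
  (X_hausdorff : hausdorff_space X) (X_compact : compact [set: X])
  (P : Prob R X) (D : Prob R X -> Prob R X -> \bar R)
  (c : X * X -> \bar R) :
  pre_divergence D ->
  weak_lsc (fun Q => D Q P) ->
  cost_function c ->
  (forall x1 x2 : X, c (x1, x2) = 0%E <-> x1 = x2) ->
  forall eps : R, 0 < eps ->
  (forall L : X -> \bar R,
     upper_semicontinuous L -> (forall x, (L x < +oo)%E) ->
     worst_case (Dc D (scale_cost r c)) P eps L @[r --> +oo]
       --> worst_case D P eps L)
  /\
  (forall (Theta : Type) (L : Theta -> X -> \bar R),
     (forall th, upper_semicontinuous (L th)) ->
     (forall th x, (L th x < +oo)%E) ->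
     ereal_inf [set worst_case (Dc D (scale_cost r c)) P eps (L th)
                  | th in [set: Theta]] @[r --> +oo]
       --> ereal_inf [set worst_case D P eps (L th) | th in [set: Theta]]).
Proof.
move=> [D0 _] lD [c0 lc] ceq0 eps eps0.
have [G [GU Goo]] := ultraFilterLemma (eventually_filter : ProperFilter \oo).
have le_W (L : X -> \bar R) : \forall r \near +oo%R,
    (worst_case D P eps L <= worst_case (Dc D (scale_cost r c)) P eps L)%E.
  by near=> r; apply: worst_case_le_scale.
have lt_W := worst_case_cvg_le X_hausdorff X_compact D0 lD c0 lc ceq0 GU Goo.
split=> [L uL Loo|Theta L uL Loo]; apply: ereal_cvg_from_above => [|a].
- exact: le_W.
- by apply: lt_W.
(* The comparison holds for all [r >= 0], hence uniformly in [th]. *)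
- near=> r; apply: le_ereal_inf_tmp => _ [th _ <-].
  apply: (@le_trans _ _ (worst_case D P eps (L th))).
    by apply: ereal_inf_lbound; exists th.
  by apply: worst_case_le_scale.
- move=> /ereal_inf_lt[_ [th _ <-] /(lt_W _ _ _ (uL th) (Loo th))].
  apply: filterS => r; apply: le_trans.
  by apply: ereal_inf_lbound; exists th.
Unshelve. all: by end_near. Qed.
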